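(* Let $a,n\in\mathbb{N}$ with $a\ge 2$ and $n\ge 1$, and let $w=(w_0\cdots w_{a^n-1})$ be a De Bruijn cycle for $\{0,1,\ldots,a-1\}^n$. Let $r\in\{1,\ldots,n\}$ satisfy $\gcd(a^n,r)=1$. For $p\in\{0,1,\ldots,a^n-1\}$, let $w[p]=w_{rp}\cdots w_{rp+n-1}\,w_{rp}\cdots w_{rp+r-1}$ (with indices taken modulo $a^n$). Then $v=(w[0]\cdots w[a^n-1])$ is an $(a,n,n+r)$-perfect necklace.
   Context: A cyclic word is a cyclically ordered sequence of letters, with indices taken modulo its length. A De Bruijn cycle for $\{0,\dots,a-1\}^n$ is a cyclic word $w=(w_0\cdots w_{a^n-1})$ over $\{0,\dots,a-1\}$ such that each word of $\{0,\dots,a-1\}^n$ equals $w_iw_{i+1}\cdots w_{i+n-1}$ for exactly one index $i$ modulo $a^n$. An $(a,n,t)$-perfect necklace is a cyclic word $v$ over $\{0,\dots,a-1\}$ of length $t\cdot a^n$ such that for every residue class $j$ modulo $t$, each word of $\{0,\dots,a-1\}^n$ equals $v_iv_{i+1}\cdots v_{i+n-1}$ for a unique index $i$ modulo $ta^n$ with $i\equiv j\pmod t$. Juxtaposition of words denotes concatenation. *)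

(* Defs.v *)
From mathcomp Require Import all_boot.

Set Implicit Arguments.
Unset Strict Implicit.
Unset Printing Implicit Defensive.

(* A cyclic word is represented by the sequence of its letters, starting from
   index 0; indices are taken modulo its length.  The head of [w] only serves
   as the default value of [nth] and is never used as such, since
   [(i + k) %% size w < size w]; the empty word has no letters to read. *)
Definition cyc_factor (T : Type) (w : seq T) (i m : nat) : seq T :=
  if w is x0 :: _ then mkseq (fun k => nth x0 w ((i + k) %% size w)) m
  else [::].

Definition de_bruijn_cycle (a n : nat) (w : seq 'I_a) : Prop :=
  size w = a ^ n /\
  forall u : n.-tuple 'I_a,
    exists! i : 'I_(a ^ n), cyc_factor w i n = u.

Definition perfect_necklace (a n t : nat) (v : seq 'I_a) : Prop :=
  size v = t * a ^ n /\
  forall (j : 'I_t) (u : n.-tuple 'I_a),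
    exists! i : 'I_(t * a ^ n), i = j %[mod t] /\ cyc_factor v i n = u.

Definition block (T : Type) (n r : nat) (w : seq T) (p : nat) : seq T :=
  cyc_factor w (r * p) n ++ cyc_factor w (r * p) r.

(* Main.v *)
Require Import Defs.
From mathcomp Require Import all_boot.
From mathcomp Require Import zify.

(** Put [N = a^n] and [t = n + r].  The block that follows [w[p]] starts with
    [w_(rp+r)], exactly where the second half of [w[p]] stops, so reading [v]
    from position [t p + q] gives [w_(rp+q)] for [q < n] and [w_(rp+q-n)] for
    [n <= q < t + n].  Hence the factor of length [n] of [v] at [t p + j] is a
    rotation of the factor of [w] at [r p] when [j <= n], and is the factor of
    [w] at [r p + j - n] when [j >= n].  In either case it determines [r p]
    modulo [N], hence [p], as [r] is prime to [N]; since there are as many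
    indices [p] as words of length [n], each word occurs exactly once. *)

Lemma cyc_factorE (T : Type) (x0 : T) (w : seq T) (i m : nat) :
  0 < size w ->
  cyc_factor w i m = mkseq (fun k => nth x0 w ((i + k) %% size w)) m.
Proof.
case: w => // y w _; apply: eq_mkseq => k.
by apply: set_nth_default; rewrite ltn_mod.
Qed.

Lemma size_cyc_factor (T : Type) (w : seq T) (i m : nat) :
  0 < size w -> size (cyc_factor w i m) = m.
Proof. by case: w => // y w _; rewrite size_mkseq. Qed.

Lemma nth_cyc_factor (T : Type) (x0 : T) (w : seq T) (i m k : nat) :
  0 < size w -> k < m ->
  nth x0 (cyc_factor w i m) k = nth x0 w ((i + k) %% size w).
Proof. by move=> w_gt0 ltkm; rewrite (cyc_factorE _ x0) // nth_mkseq. Qed.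

Lemma size_flatten_uniform (T : Type) (t : nat) (ss : seq (seq T)) :
  all (fun s => size s == t) ss -> size (flatten ss) = t * size ss.
Proof.
elim: ss => [|s ss IH] /=; first by rewrite muln0.
by case/andP=> /eqP sz /IH szs; rewrite size_cat sz szs mulnS.
Qed.

Lemma nth_flatten_uniform (T : Type) (x0 : T) (t : nat) (ss : seq (seq T))
    (p q : nat) :
  all (fun s => size s == t) ss -> q < t ->
  nth x0 (flatten ss) (t * p + q) = nth x0 (nth [::] ss p) q.
Proof.
move=> + ltqt; elim: ss p => [|s ss IH] p /=; first by rewrite !nth_nil.
case/andP=> /eqP sz szs; rewrite nth_cat sz.
case: p => [|p]; first by rewrite muln0 add0n ltqt.
by rewrite mulnS -addnA ltnNge leq_addr /= addKn IH.
Qed.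

(** The residues of [x] and [y] modulo [a ^ n] are both indices at which the same word occurs, and
    such an index is unique. *)
Lemma de_bruijn_factor_inj (a n : nat) (w : seq 'I_a) (x y : nat) :
  0 < size w -> de_bruijn_cycle n w ->
  cyc_factor w x n = cyc_factor w y n -> x = y %[mod a ^ n].
Proof.
move=> w_gt0 [szw dbw] eqxy.
have N_gt0 : 0 < a ^ n by rewrite -szw.
have factor_mod z : cyc_factor w (z %% a ^ n) n = cyc_factor w z n.
  case: w w_gt0 szw {dbw eqxy} => // x0 w _ szw.
  by apply: eq_mkseq => k; rewrite szw modnDml.
have szu : size (cyc_factor w y n) == n by rewrite size_cyc_factor.
have [i [_ uniq_i]] := dbw (Tuple szu).
have := uniq_i (Ordinal (ltn_pmod x N_gt0)).
rewrite /= factor_mod => /(_ eqxy) eqx.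
have := uniq_i (Ordinal (ltn_pmod y N_gt0)).
rewrite /= factor_mod => /(_ erefl) eqy.
by have := congr1 val eqx; rewrite eqy.
Qed.

Section Interleaving.

Variables (T : Type) (x0 : T) (n r : nat) (w : seq T).
Hypothesis w_gt0 : 0 < size w.

Let v := flatten (mkseq (block n r w) (size w)).

Lemma size_block (p : nat) : size (block n r w p) = n + r.
Proof. by rewrite size_cat !size_cyc_factor. Qed.

Lemma all_size_blocks (m : nat) :
  all (fun s => size s == n + r) (mkseq (block n r w) m).
Proof. by rewrite all_map; apply/allP => p _; rewrite /= size_block. Qed.

Lemma size_flatten_blocks : size v = (n + r) * size w.
Proof.
by rewrite (size_flatten_uniform _ _ _ (all_size_blocks _)) size_mkseq.
Qed.

Lemma nth_flatten_blocks (p q : nat) : q < n + r ->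
  nth x0 v (((n + r) * p + q) %% size v) =
  nth x0 w ((r * p + (if q < n then q else q - n)) %% size w).
Proof.
move=> ltqt; have t_gt0 : 0 < n + r by apply: leq_ltn_trans ltqt.
have ltpN : p %% size w < size w by rewrite ltn_mod.
(* As [size v] is [n + r] times [size w], wrapping around [v] only reduces the block index. *)
have -> : ((n + r) * p + q) %% size v = (n + r) * (p %% size w) + q.
  rewrite size_flatten_blocks {1}(divn_eq p (size w)) mulnDr mulnCA -addnA.
  rewrite modnMDl modn_small //; nia.
rewrite (nth_flatten_uniform _ _ _ _ _ _ (all_size_blocks _)) //.
rewrite nth_mkseq // nth_cat size_cyc_factor //.
by case: ifP => ltqn; rewrite nth_cyc_factor; try lia;
  rewrite -modnDml modnMmr modnDml.
Qed.

(** For [q >= n + r] the letter lies in the first half of the next block, at [r * p.+1 + (q - (n +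
    r)) = r * p + (q - n)] in [w]. The range of [q] covers every factor of length [n] that starts in
    block [p]. *)
Lemma nth_flatten_blocks_overlap (p q : nat) : 0 < n + r -> q < n + r + n ->
  nth x0 v (((n + r) * p + q) %% size v) =
  nth x0 w ((r * p + (if q < n then q else q - n)) %% size w).
Proof.
move=> t_gt0 ltq; have [|letq] := ltnP q (n + r).
  exact: nth_flatten_blocks.
have -> : (n + r) * p + q = (n + r) * p.+1 + (q - (n + r)) by lia.
have ltn' : q - (n + r) < n by lia.
rewrite nth_flatten_blocks ?ltn'; last by lia.
by congr (nth _ _ (_ %% _)); rewrite ifF; lia.
Qed.

End Interleaving.

Theorem proposition4p2 (a n : nat) (ha : 2 <= a) (hn : 1 <= n)
    (w : seq 'I_a) (hw : de_bruijn_cycle n w)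
    (r : nat) (hr : 1 <= r <= n) (hcop : gcdn (a ^ n) r = 1) :
  perfect_necklace n (n + r) (flatten (mkseq (block n r w) (a ^ n))).
Proof.
have szw := hw.1.
have N_gt0 : 0 < a ^ n by rewrite expn_gt0; lia.
have w_gt0 : 0 < size w by rewrite szw.
have t_gt0 : 0 < n + r by lia.
pose x0 : 'I_a := Ordinal (ltnW ha).
set v := flatten _.
have szv : size v = (n + r) * a ^ n.
  by rewrite /v -szw; apply: size_flatten_blocks.
have v_gt0 : 0 < size v by rewrite szv muln_gt0 t_gt0.
have vE p q : q < n + r + n ->
    nth x0 v (((n + r) * p + q) %% size v) =
    nth x0 w ((r * p + (if q < n then q else q - n)) %% size w).
  by rewrite /v -szw; apply: nth_flatten_blocks_overlap.
split=> // j u.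
have szf p : size (cyc_factor v ((n + r) * p + j) n) == n.
  by rewrite size_cyc_factor.
pose f (p : 'I_(a ^ n)) : n.-tuple 'I_a := Tuple (szf p).
have f_inj : injective f.
  move=> p p' /(congr1 val) /= eqf.
  (* Truncated subtraction merges the two cases: the offset [j - n] is 0 when [j <= n]. *)
  have eqw : cyc_factor w (r * p + (j - n)) n =
             cyc_factor w (r * p' + (j - n)) n.
    apply: (@eq_from_nth _ x0); rewrite !size_cyc_factor // => l ltln.
    rewrite !nth_cyc_factor // -!addnA.
    have ltjt := ltn_ord j.
    (* [k] is the place, in the factor of [v], of letter [l] of the factor of [w]. For [j < n] the
       offsets read are [j], ..., [n - 1], then 0, ..., [j - 1], so the rotation by [j] is
       undone. *)
    have [k ltkn foldk] :
        exists2 k, k < n & (if j + k < n then j + k else j + k - n) = j - n + l.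
      exists (if n <= j then l else if l < j then l + n - j else l - j).
        by case: ifP => ?; [|case: ifP => ?]; lia.
      by case: (leqP n j) => ?; [|case: (ltnP l j) => ?]; case: ifP => ?; lia.
    have := congr1 (fun s => nth x0 s k) eqf.
    rewrite !nth_cyc_factor // -!addnA !vE ?foldk //; lia.
  have /eqP := de_bruijn_factor_inj _ _ _ _ _ w_gt0 hw eqw.
  rewrite eqn_modDr => eqrp; apply/val_inj => /=.
  rewrite -(modn_small (ltn_ord p)) -(modn_small (ltn_ord p')).
  (* With [p' <= p], the congruence says that [a ^ n] divides [r * (p - p')], and coprimality
     removes [r]. *)
  wlog lepp : p p' eqrp {eqf eqw} / p' <= p.
    by move=> W; case/orP: (leq_total p' p) => le;
       [|symmetry]; apply: W; rewrite // eq_sym.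
  apply/eqP; rewrite eqn_mod_dvd //.
  move: eqrp; rewrite eqn_mod_dvd ?leq_mul2l ?lepp ?orbT // -mulnBr.
  by rewrite Gauss_dvdr // /coprime hcop.
have [g fK gK] : bijective f.
  by apply: inj_card_bij => //; rewrite card_tuple !card_ord.
have lti : (n + r) * g u + j < (n + r) * a ^ n.
  by have := ltn_ord j; have := ltn_ord (g u); nia.
exists (Ordinal lti); split=> [|i' [modi' faci']].
  split; first by rewrite /= mulnC modnMDl.
  exact: (congr1 val (gK u)).
(* Uniqueness: an index congruent to [j] starts at offset [j] of its block, so its factor is a value
   of [f], and [g] recovers the block. *)
have ltp' : i' %/ (n + r) < a ^ n by rewrite ltn_divLR // [a ^ n * _]mulnC.
have i'E : i' = (n + r) * (i' %/ (n + r)) + j :> nat.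
  by rewrite {1}(divn_eq i' (n + r)) modi' (modn_small (ltn_ord j)) mulnC.
have fu : f (Ordinal ltp') = u by apply: val_inj; rewrite /= -i'E.
by apply: val_inj; rewrite /= -fu fK /= -i'E.
Qed.
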